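(* Let $\phi$ be analytic in $\mathbb{U}$ with $\phi(0)=1$ and suppose that $\alpha_a$ is independent of $a$. If $f\in\mathcal{A}_p$, then $$\Omega_{L,\mu,\nu}^{a}(f(z))\prec\phi(z)\iff\Omega_{L,\mu,\nu}^{a+1}(F(z))\prec\phi(z).$$ Further, $$\phi(z)\prec\Omega_{L,\mu,\nu}^{a}(f(z))\iff\phi(z)\prec\Omega_{L,\mu,\nu}^{a+1}(F(z)),$$ where $F$ is defined by $$F(z):=\frac{\alpha_a}{z^{\alpha_a-p}}\int_0^z t^{\alpha_a-p-1}f(t)\,dt.$$
   Context: $\mathbb{U}=\{z\in\mathbb{C}:|z|<1\}$; $p$ is a positive integer; $\mathcal{A}_p$ is the class of all analytic functions in $\mathbb{U}$ of the form $f(z)=z^p+\sum_{k=p+1}^\infty a_kz^k$. For two analytic functions $g$ and $h$ in $\mathbb{U}$, $g$ is subordinate to $h$ (equivalently, $h$ is superordinate to $g$), written $g\prec h$, if there is a Schwarz function $w$ (analytic in $\mathbb{U}$) with $|w(z)|\le|z|$ such that $g(z)=h(w(z))$. $O_p$ denotes the class of all linear operators $L_p^a$ defined on $\mathcal{A}_p$ satisfying $$z[L_p^{a}f(z)]'=\alpha_aL_p^{a+1}f(z)-(\alpha_a-p)L_p^{a}f(z),$$ where $a$ is the parameter indexing the operators and $\alpha_a$ is a number that may in general depend on $a$; the operators $L_p^a$ in the theorem are of this class. For $f\in\mathcal{A}_p$, $$\Omega_{L,\mu,\nu}^a(f(z))=\left(\frac{L_p^{a+1}f(z)}{z^p}\right)^\mu\left(\frac{z^p}{L_p^af(z)}\right)^\nu,$$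 where the powers are principal ones, and $\mu$ and $\nu$ are real numbers that do not assume the value zero simultaneously.
   Formalization: The operators are additionally assumed to satisfy L_p^a[z f'] = z (L_p^a f)' (as convolution operators do); without this the claim fails for some linear operators in O_p. The integral defining F is assumed to converge. *)

(* Defs.v *)
From Stdlib Require Import Reals.
From Coquelicot Require Import Coquelicot.

Open Scope C_scope.

Definition in_U (z : C) : Prop := (Cmod z < 1)%R.

(* Functions on the disc are represented by total functions [C -> C]; only the
   values on the disc are ever constrained or used. *)
Definition analytic_in_U (g : C -> C) : Prop :=
  forall z : C, in_U z -> @ex_derive C_AbsRing C_NormedModule g z.

Definition class_A (p : nat) (f : C -> C) : Prop :=
  analytic_in_U f /\
  exists u : nat -> C,
    (forall k : nat, (k < p)%nat -> u k = 0) /\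
    u p = 1 /\
    forall z : C, in_U z -> @is_pseries C_AbsRing C_NormedModule u z (f z).

Definition Cexp (z : C) : C := (exp (Re z) * cos (Im z), exp (Re z) * sin (Im z))%R.

(* Principal argument, in (-PI, PI] for z <> 0. *)
Definition Carg (z : C) : R :=
  if Rlt_dec (Im z) 0 then (- acos (Re z / Cmod z))%R else acos (Re z / Cmod z).

Definition Clog (z : C) : C := (ln (Cmod z), Carg z).

(* Principal power.  The value at base 0 makes [cpower (/ 0) (- nu)], with
   Rocq's [/ 0 = 0], equal to [cpower 0 nu] (namely 0) when nu > 0. *)
Definition cpower (z c : C) : C :=
  if Ceq_dec z 0 then (if Ceq_dec c 0 then 1 else 0) else Cexp (c * Clog z).

Definition Schwarz (w : C -> C) : Prop :=
  analytic_in_U w /\ forall z : C, in_U z -> (Cmod (w z) <= Cmod z)%R.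

(* Subordination is a relation between analytic functions, so analyticity of
   both sides is part of the assertion. *)
Definition subordinate (g h : C -> C) : Prop :=
  analytic_in_U g /\ analytic_in_U h /\
  exists w : C -> C, Schwarz w /\ forall z : C, in_U z -> g z = h (w z).

(* [class_A p] is not a vector space: linearity is required for the linear
   combinations that stay in it.  Taking c = 1, d = 0 shows that T f on the disc
   depends only on f on the disc. *)
Definition linear_operator (p : nat) (T : (C -> C) -> C -> C) : Prop :=
  (forall f : C -> C, class_A p f -> class_A p (T f)) /\
  forall (f g h : C -> C) (c d : C),
    class_A p f -> class_A p g -> class_A p h ->
    (forall z : C, in_U z -> h z = c * f z + d * g z) ->
    forall z : C, in_U z -> T h z = c * T f z + d * T g z.

(* The set I of admissible parameters is left arbitrary (up to closure under
   a |-> a + 1), so that integer, real and complex parameters are all covered. *)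
Definition class_O (p : nat) (I : C -> Prop) (alpha : C -> C)
    (L : C -> (C -> C) -> C -> C) : Prop :=
  (forall a : C, I a -> I (a + 1)) /\
  (forall a : C, I a -> linear_operator p (L a)) /\
  forall (a : C) (f : C -> C), I a -> class_A p f ->
    forall z : C, in_U z ->
      z * C_derive (L a f) z
      = alpha a * L (a + 1) f z - (alpha a - INR p) * L a f z.

(* T[z f'] = z (T f)'.  Since z f' has leading coefficient p, it is z f' / p
   (called g below) that lies in [class_A p].  For linear T on [class_A p] this
   says that T multiplies the k-th Taylor coefficient by a fixed constant, i.e.
   that T is a Hadamard product with a fixed series. *)
Definition commutes_with_zderiv (p : nat) (T : (C -> C) -> C -> C) : Prop :=
  forall f g : C -> C, class_A p f -> class_A p g ->
    (forall z : C, in_U z -> INR p * g z = z * C_derive f z) ->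
    forall z : C, in_U z -> INR p * T g z = z * C_derive (T f) z.

(* At z = 0 both quotients have removable singularities with value 1. *)
Definition Omega (p : nat) (L : C -> (C -> C) -> C -> C) (mu nu : R) (a : C)
    (f : C -> C) (z : C) : C :=
  if Ceq_dec z 0 then 1
  else cpower (L (a + 1) f z / z ^ p) mu * cpower (z ^ p / L a f z) nu.

(* t^(c-p-1) f(t) dt along the segment t = s z, 0 < s <= 1. *)
Definition segment_integrand (p : nat) (c : C) (f : C -> C) (z : C) (s : R) : C :=
  cpower (s * z) (c - INR p - 1) * f (s * z) * z.

(* The integral is improper at the end point 0. *)
Definition ex_segment_integral (p : nat) (c : C) (f : C -> C) (z : C) : Prop :=
  @ex_RInt_gen C_R_NormedModule (segment_integrand p c f z)
    (at_right 0) (at_point 1).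

Definition segment_integral (p : nat) (c : C) (f : C -> C) (z : C) : C :=
  @RInt_gen C_R_CompleteNormedModule (segment_integrand p c f z)
    (at_right 0) (at_point 1).

(* At z = 0 the formula has a removable singularity with value 0. *)
Definition integral_operator (p : nat) (c : C) (f : C -> C) (z : C) : C :=
  if Ceq_dec z 0 then 0
  else c / cpower z (c - INR p) * segment_integral p c f z.

(* Main.v *)
Require Import Defs.
From Stdlib Require Import Reals Lra Lia Arith IndefiniteDescription.
From Coquelicot Require Import Coquelicot.
Local Open Scope C_scope.

(* Write c for the common value of the alpha_a.  Convergence of the integral
   defining F forces Re c > 0.  Then F is the sum of the power series with
   coefficients c / (c + k - p) * u_k, where u_k are those of f: this sum h
   solves z h' = c f - (c - p) h, so s^(c-p) h(s z) is, up to a constant, an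
   antiderivative of the integrand, and it vanishes at s = 0.  Hence F is in A_p
   and z F' / p = (c / p) f + (1 - c / p) F.  Applying L^b, which is linear and
   commutes with z d/dz, and comparing with the recurrence defining O_p gives
   c L^(b+1) F = c L^b f, so Omega^(a+1)(F) = Omega^a(f) on U. *)

(** Only convergence of the improper integral is available, not absolute convergence, so [Re c > 0]
    cannot be obtained by comparing moduli; an oscillating integrand has to be excluded as well.

    The principal powers cause no trouble because each integral lives on one segment from 0: the
    argument is constant there, and the branch-dependent factor z^(c-p) leaves the integral and
    cancels against the denominator in the definition of F. Analyticity of F, also across the cut,
    is then read off from the power series h, without differentiating under an integral sign.

    The shift is needed at two parameters for the same F, namely b = a and b = a + 1, since
    Omega^(a+1)(F) contains both L^(a+1) F and L^(a+2) F. As F is built from alpha_a, this is where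
    the independence of alpha_a from a enters. Omega^(a+1)(F) and Omega^a(f) then agree pointwise on
    U, base by base, which settles both equivalences at once. *)

(** * Complex derivatives and derivatives along a real parameter *)

Lemma is_derive_C_iff (g : C -> C) (w d : C) :
  @is_derive C_AbsRing C_NormedModule g w d <->
  forall eps : R, (0 < eps)%R -> exists delta : R, (0 < delta)%R /\
    forall y : C, (Cmod (y - w) < delta)%R ->
      (Cmod (g y - g w - (y - w) * d) <= eps * Cmod (y - w))%R.
Proof.
split.
- intros [_ H] eps Heps.
  destruct (H w (fun P HP => HP) (mkposreal eps Heps)) as [del Hdel].
  exists del; split; [apply cond_pos|].
  intros y Hy. apply (Hdel y Hy).
- intros H; split.
  + apply is_linear_scal_l.
  + intros x Hx eps.
    assert (E : w = x) by exact (@is_filter_lim_locally_unique _ (AbsRing_NormedModule C_AbsRing) w x Hx).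
    subst x.
    destruct (H eps (cond_pos eps)) as (del & Hdel & Hy).
    exists (mkposreal del Hdel); intros y B; apply (Hy y B).
Qed.

Lemma is_derive_R_iff (g : R -> R) (w d : R) :
  is_derive g w d <->
  forall eps : R, (0 < eps)%R -> exists delta : R, (0 < delta)%R /\
    forall y : R, (Rabs (y - w) < delta)%R ->
      (Rabs (g y - g w - (y - w) * d) <= eps * Rabs (y - w))%R.
Proof.
split.
- intros [_ H] eps Heps.
  destruct (H w (fun P HP => HP) (mkposreal eps Heps)) as [del Hdel].
  exists del; split; [apply cond_pos|].
  intros y Hy. apply (Hdel y Hy).
- intros H; split.
  + apply is_linear_scal_l.
  + intros x Hx eps.
    assert (E : w = x) by exact (@is_filter_lim_locally_unique _ (AbsRing_NormedModule R_AbsRing) w x Hx).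
    subst x.
    destruct (H eps (cond_pos eps)) as (del & Hdel & Hy).
    exists (mkposreal del Hdel); intros y B; apply (Hy y B).
Qed.

Lemma Im_le_Cmod (z : C) : (Rabs (Im z) <= Cmod z)%R.
Proof. eapply Rle_trans; [|apply Rmax_Cmod]. apply Rmax_r. Qed.

(** Componentwise, because the fundamental theorem of calculus and the mean value theorem are
    applied below to real functions. *)
Definition is_derive_RC (g : R -> C) (s : R) (l : C) : Prop :=
  is_derive (fun t => Re (g t)) s (Re l) /\
  is_derive (fun t => Im (g t)) s (Im l).

Lemma is_derive_RC_comp (g : C -> C) (z d : C) (s : R) :
  @is_derive C_AbsRing C_NormedModule g (s * z) d ->
  is_derive_RC (fun t : R => g (t * z)) s (z * d).
Proof.
intros H; pose proof (proj1 (is_derive_C_iff _ _ _) H) as H'.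
assert (K : forall eps : R, (0 < eps)%R -> exists delta : R, (0 < delta)%R /\
    forall y : R, (Rabs (y - s) < delta)%R ->
      (Cmod (g (RtoC y * z)%C - g (RtoC s * z)%C - RtoC (y - s) * (z * d))%C <= eps * Rabs (y - s))%R).
{ intros eps Heps.
  pose proof (Cmod_ge_0 z) as Hz.
  (* Dividing by [Cmod z + 1] instead of [Cmod z] keeps z = 0 in the same argument. *)
  destruct (H' (eps / (Cmod z + 1))%R) as (del & Hdel & Hy).
  { apply Rdiv_lt_0_compat; lra. }
  exists (del / (Cmod z + 1))%R; split. { apply Rdiv_lt_0_compat; lra. }
  intros y Y. specialize (Hy (y * z)).
  replace (y * z - s * z) with ((y - s)%R * z) in Hy by (rewrite RtoC_minus; ring).
  rewrite Cmod_mult, Cmod_R in Hy.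
  replace ((y - s)%R * (z * d)) with ((y - s)%R * z * d) by ring.
  pose proof (Rabs_pos (y - s)) as Ha.
  eapply Rle_trans; [apply Hy|].
  - apply (Rmult_lt_compat_r (Cmod z + 1)) in Y; [|lra].
    replace (del / (Cmod z + 1) * (Cmod z + 1))%R with del in Y by (field; lra). nra.
  - replace (eps / (Cmod z + 1) * (Rabs (y - s) * Cmod z))%R
      with (eps * Rabs (y - s) * (Cmod z / (Cmod z + 1)))%R by (field; lra).
    assert (Cmod z / (Cmod z + 1) <= 1)%R.
    { apply (Rmult_le_reg_r (Cmod z + 1)); [lra|]. field_simplify; lra. }
    pose proof (Rmult_le_pos eps _ (Rlt_le _ _ Heps) Ha). nra. }
split; apply is_derive_R_iff; intros eps Heps;
  destruct (K eps Heps) as (del & Hdel & Hy); exists del; split; auto; intros y Y;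
  (eapply Rle_trans; [|apply (Hy y Y)]).
- eapply Rle_trans; [|apply re_le_Cmod]. apply Req_le; f_equal.
  destruct (g (y*z)), (g (s*z)), z, d; simpl; ring.
- eapply Rle_trans; [|apply Im_le_Cmod]. apply Req_le; f_equal.
  destruct (g (y*z)), (g (s*z)), z, d; simpl; ring.
Qed.

Lemma is_derive_RC_mult (g h : R -> C) (s : R) (dg dh : C) :
  is_derive_RC g s dg -> is_derive_RC h s dh ->
  is_derive_RC (fun t => g t * h t) s (dg * h s + g s * dh).
Proof.
intros [G1 G2] [H1 H2]; split.
- replace (Re (dg * h s + g s * dh)) with
    ((Re dg * Re (h s) + Re (g s) * Re dh) - (Im dg * Im (h s) + Im (g s) * Im dh))%R
    by (unfold Re, Im; simpl; ring).
  apply (is_derive_minus (fun t => (Re (g t) * Re (h t))%R) (fun t => (Im (g t) * Im (h t))%R));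
    apply is_derive_Reals; apply derivable_pt_lim_mult; apply is_derive_Reals; assumption.
- replace (Im (dg * h s + g s * dh)) with
    ((Re dg * Im (h s) + Re (g s) * Im dh) + (Im dg * Re (h s) + Im (g s) * Re dh))%R
    by (unfold Re, Im; simpl; ring).
  apply (is_derive_plus (fun t => (Re (g t) * Im (h t))%R) (fun t => (Im (g t) * Re (h t))%R));
    apply is_derive_Reals; apply derivable_pt_lim_mult; apply is_derive_Reals; assumption.
Qed.

(* The principal power [s ^ c] for [0 < s]; since [ln] is [0] on the nonpositive
   reals, [rpow s c = 1] there. *)
Definition rpow (s : R) (c : C) : C := Cexp (c * ln s).

(** * Exponential, principal logarithm and principal powers *)

Lemma Cexp_plus (x y : C) : Cexp (x + y) = Cexp x * Cexp y.
Proof.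
unfold Cexp, Re, Im. simpl. rewrite exp_plus, cos_plus, sin_plus.
unfold Cmult; simpl. f_equal; ring.
Qed.

Lemma Cmod_Cexp (x : C) : Cmod (Cexp x) = exp (Re x).
Proof.
unfold Cmod, Cexp; simpl fst; simpl snd.
replace ((exp (Re x) * cos (Im x)) ^ 2 + (exp (Re x) * sin (Im x)) ^ 2)%R
  with (Rsqr (exp (Re x))).
- apply sqrt_Rsqr, Rlt_le, exp_pos.
- pose proof (sin2_cos2 (Im x)) as H. unfold Rsqr in *.
  transitivity (exp (Re x) * exp (Re x) * (sin (Im x) * sin (Im x) + cos (Im x) * cos (Im x)))%R; [rewrite H; ring|ring].
Qed.

Lemma Cexp_neq_0 (x : C) : Cexp x <> 0.
Proof.
intros H. pose proof (Cmod_Cexp x) as K. rewrite H, Cmod_0 in K.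
pose proof (exp_pos (Re x)); lra.
Qed.

Lemma Cmod_rpow (s : R) (c : C) : Cmod (rpow s c) = exp (Re c * ln s).
Proof. unfold rpow. rewrite Cmod_Cexp. f_equal. unfold Re; simpl. ring. Qed.

Lemma rpow_plus (s : R) (c d : C) : rpow s (c + d) = rpow s c * rpow s d.
Proof. unfold rpow. rewrite <- Cexp_plus. f_equal. ring. Qed.

Lemma rpow_0 (s : R) : rpow s 0 = 1.
Proof.
unfold rpow. rewrite Cmult_0_l. unfold Cexp, Re, Im, RtoC; simpl.
rewrite exp_0, cos_0, sin_0. f_equal; ring.
Qed.

Lemma rpow_1 (s : R) : (0 < s)%R -> rpow s 1 = s.
Proof.
intros H. unfold rpow, Cexp. rewrite Cmult_1_l. simpl. rewrite exp_ln, cos_0, sin_0 by assumption.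
unfold RtoC. f_equal; ring.
Qed.

Lemma rpow_base1 (c : C) : rpow 1 c = 1.
Proof.
unfold rpow. rewrite ln_1, Cmult_0_r. replace (RtoC 0) with (0 * ln 1) by ring. apply rpow_0.
Qed.

Lemma rpow_nat (s : R) (n : nat) : (0 < s)%R -> rpow s (INR n) = s ^ n.
Proof.
intros H. induction n.
- apply rpow_0.
- rewrite S_INR, RtoC_plus, rpow_plus, IHn, rpow_1 by assumption. simpl. ring.
Qed.

Lemma is_derive_rpow (c : C) (s : R) : (0 < s)%R ->
  is_derive_RC (fun t => rpow t c) s (c * rpow s (c - 1)).
Proof.
intros Hs.
assert (E : rpow s (c - 1) = rpow s c / s).
{ assert (rpow s c = rpow s (c - 1) * s).
  { rewrite <- (rpow_1 s) by assumption. rewrite <- rpow_plus. f_equal. ring. }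
  rewrite H. field. intros K; apply RtoC_inj in K; lra. }
rewrite E. clear E.
unfold rpow, Cexp, Re, Im; destruct c as [x y].
split; simpl.
- auto_derive; [auto|].
  replace (x * ln s + - (y * 0))%R with (x * ln s - y * 0)%R by ring. field. lra.
- auto_derive; [auto|].
  replace (x * ln s + - (y * 0))%R with (x * ln s - y * 0)%R by ring. field. lra.
Qed.

Lemma Carg_scale (s : R) (z : C) : (0 < s)%R -> Carg (s * z) = Carg z.
Proof.
intros Hs. unfold Carg.
replace (Re (s * z)) with (s * Re z)%R by (unfold Re; simpl; ring).
replace (Im (s * z)) with (s * Im z)%R by (unfold Im; simpl; ring).
rewrite Cmod_mult, Cmod_R, Rabs_pos_eq by lra.
assert (E : (s * Re z / (s * Cmod z) = Re z / Cmod z)%R).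
{ unfold Rdiv. rewrite Rinv_mult.
  transitivity ((s * / s) * (Re z * / Cmod z))%R; [ring|]. rewrite Rinv_r by lra. ring. }
rewrite E.
destruct (Rlt_dec (s * Im z) 0) as [H|H], (Rlt_dec (Im z) 0) as [K|K]; auto; exfalso; nra.
Qed.

Lemma Clog_scale (s : R) (z : C) : (0 < s)%R -> z <> 0 -> Clog (s * z) = ln s + Clog z.
Proof.
intros Hs Hz. unfold Clog. rewrite Carg_scale, Cmod_mult, Cmod_R, Rabs_pos_eq by lra.
rewrite ln_mult by (try assumption; apply Cmod_gt_0; assumption).
unfold Cplus, RtoC; simpl. f_equal; ring.
Qed.

(** The point s z stays on the ray through z, so its principal argument does not change and no
    branch jump occurs, even on the negative real axis. *)
Lemma cpower_scale (s : R) (z d : C) : (0 < s)%R -> z <> 0 ->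
  cpower (s * z) d = rpow s d * cpower z d.
Proof.
intros Hs Hz. unfold cpower.
destruct (Ceq_dec z 0) as [E|_]; [contradiction|].
destruct (Ceq_dec (s * z) 0) as [E|_].
- exfalso. revert E. apply Cmult_neq_0; [|assumption]. intros E. apply RtoC_inj in E. lra.
- rewrite Clog_scale by assumption. unfold rpow. rewrite <- Cexp_plus. f_equal. ring.
Qed.

Lemma cpower_neq_0 (z d : C) : z <> 0 -> cpower z d <> 0.
Proof.
intros Hz. unfold cpower. destruct (Ceq_dec z 0) as [E|_]; [contradiction|]. apply Cexp_neq_0.
Qed.

(** The sine of [acos (Re z / Cmod z)] only gives |Im z| / |z|; the case distinction in [Carg]
    restores the sign. *)
Lemma Cexp_Clog (z : C) : z <> 0 -> Cexp (Clog z) = z.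
Proof.
intros Hz. pose proof (proj1 (Cmod_gt_0 z) Hz) as Hm.
pose proof (Cmod2_alt z) as H2.
assert (B : (-1 <= Re z / Cmod z <= 1)%R).
{ pose proof (re_le_Cmod z) as H. apply Rabs_le_between in H.
  split; apply (Rmult_le_reg_r (Cmod z)); trivial; field_simplify; lra. }
assert (S : (sqrt (1 - (Re z / Cmod z)²) = Rabs (Im z) / Cmod z)%R).
{ replace (1 - (Re z / Cmod z)²)%R with ((Rabs (Im z) / Cmod z)²)%R.
  - apply sqrt_Rsqr. apply Rdiv_le_0_compat; [apply Rabs_pos|assumption].
  - rewrite Rsqr_div', <- Rsqr_abs. rewrite Rsqr_div'.
    unfold Rsqr. apply (Rmult_eq_reg_r (Cmod z * Cmod z)); [|nra].
    field_simplify; [|lra|lra]. lra. }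
unfold Cexp, Clog, Carg. simpl. rewrite exp_ln by assumption.
transitivity (Re z, Im z); [|destruct z; reflexivity].
destruct (Rlt_dec (Im z) 0) as [H|H].
- rewrite cos_neg, sin_neg, cos_acos, sin_acos, S, Rabs_left by assumption.
  unfold Re, Im in *. f_equal; field; lra.
- rewrite cos_acos, sin_acos, S, Rabs_pos_eq by lra.
  unfold Re, Im in *. f_equal; field; lra.
Qed.

Lemma cpower_succ (z d : C) : z <> 0 -> cpower z (d + 1) = cpower z d * z.
Proof.
intros Hz. unfold cpower. destruct (Ceq_dec z 0) as [E|_]; [contradiction|].
replace ((d + 1) * Clog z) with (d * Clog z + Clog z) by ring.
rewrite Cexp_plus, Cexp_Clog by assumption. reflexivity.
Qed.

(** * Power series with complex coefficients *)

Notation is_Cseries := (@is_series C_AbsRing C_NormedModule).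
Notation is_Cpseries := (@is_pseries C_AbsRing C_NormedModule).

Lemma is_Cpseries_iff (u : nat -> C) (z l : C) :
  is_Cpseries u z l <-> is_Cseries (fun k => z ^ k * u k) l.
Proof.
assert (E : forall k, @pow_n C_Ring z k = z ^ k).
{ induction k; [reflexivity|]. simpl. rewrite IHk. reflexivity. }
unfold is_pseries.
split; apply is_series_ext; intros k; simpl; rewrite <- E; reflexivity.
Qed.

Lemma is_Cseries_unique (a : nat -> C) (l l' : C) :
  is_Cseries a l -> is_Cseries a l' -> l = l'.
Proof. intros H H'. exact (filterlim_locally_unique (F := eventually) _ l l' H H'). Qed.

Lemma is_Cseries_norm_le (a : nat -> C) (c : nat -> R) (l : C) (S : R) :
  is_Cseries a l -> (forall k, (Cmod (a k) <= c k)%R) -> is_series c S -> (Cmod l <= S)%R.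
Proof.
intros Ha Hc HS.
assert (H : is_lim_seq (fun n => Cmod (sum_n a n : C)) (Cmod l)).
{ unfold is_lim_seq; simpl.
  eapply filterlim_comp; [exact Ha|].
  exact (@filterlim_norm C_AbsRing C_NormedModule l). }
assert (HS' : is_lim_seq (fun n => sum_n c n) S) by exact HS.
refine (is_lim_seq_le _ _ (Cmod l) S _ H HS').
intros n. eapply Rle_trans.
- exact (@norm_sum_n_m C_AbsRing C_NormedModule a 0 n).
- apply sum_n_m_le. exact Hc.
Qed.

Lemma is_Cseries_bounded (a : nat -> C) (l : C) :
  is_Cseries a l -> exists M : R, forall k, (Cmod (a k) <= M)%R.
Proof.
intros H.
destruct (@filterlim_bounded C_AbsRing C_NormedModule (sum_n a)) as [M HM]; [exists l; exact H|].
assert (HM' : forall n, (Cmod (sum_n a n) <= M)%R) by exact HM.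
exists (2 * M)%R. intros [|k].
- specialize (HM' 0%nat). rewrite sum_O in HM'. pose proof (Cmod_ge_0 (a 0%nat)). lra.
- replace (a (S k)) with (sum_n a (S k) + - sum_n a k).
  + eapply Rle_trans; [apply Cmod_triangle|]. rewrite Cmod_opp.
    pose proof (HM' k). pose proof (HM' (S k)). lra.
  + rewrite sum_Sn. change plus with Cplus. ring.
Qed.

(** Convergence at a real point r < 1 bounds the terms |u k| r^k, as in Abel's lemma. Passing to
    moduli gives access to the theory of real power series, in particular to the radius of a derived
    series. *)
Lemma CV_radius_Cmod (u : nat -> C) :
  (forall z, in_U z -> exists l, is_Cpseries u z l) ->
  Rbar_le 1 (CV_radius (fun k => Cmod (u k))).
Proof.
intros H.
destruct (CV_radius_bounded (fun k => Cmod (u k))) as [Hub _].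
assert (K : forall r : R, (0 <= r < 1)%R -> Rbar_le r (CV_radius (fun k => Cmod (u k)))).
{ intros r Hr. apply Hub.
  destruct (H r) as [l Hl].
  { unfold in_U. rewrite Cmod_R, Rabs_pos_eq; lra. }
  apply is_Cpseries_iff in Hl. apply is_Cseries_bounded in Hl as [M HM].
  exists M. intros n. specialize (HM n).
  rewrite Cmod_mult, Cmod_pow, Cmod_R, Rabs_pos_eq in HM by lra.
  rewrite Rabs_pos_eq; [lra|].
  apply Rmult_le_pos; [apply Cmod_ge_0|apply pow_le; lra]. }
destruct (CV_radius (fun k => Cmod (u k))) as [R| |]; simpl in *; auto.
- destruct (Rle_lt_dec 1 R) as [|L]; auto. exfalso.
  pose proof (K 0%R ltac:(lra)).
  specialize (K ((R + 1) / 2)%R). lra.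
- apply (K 0%R). lra.
Qed.

Lemma ex_Cpseries (u : nat -> C) (b : nat -> R) :
  (forall k, (Cmod (u k) <= b k)%R) -> Rbar_le 1 (CV_radius b) ->
  forall z, in_U z -> exists l, is_Cpseries u z l.
Proof.
intros Hub Hb z Hz.
assert (E : ex_series (fun k => (b k * Cmod z ^ k)%R)).
{ apply ex_pseries_R, CV_radius_inside.
  eapply Rbar_lt_le_trans; [|exact Hb]. simpl.
  rewrite Rabs_pos_eq by apply Cmod_ge_0. exact Hz. }
destruct (@ex_series_le C_AbsRing C_CompleteNormedModule (fun k => z ^ k * u k)
  (fun k => (b k * Cmod z ^ k)%R)) with (2 := E)
  as [l Hl].
- intros k. change (Cmod (z ^ k * u k) <= b k * Cmod z ^ k)%R.
  rewrite Cmod_mult, Cmod_pow, Rmult_comm.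
  apply Rmult_le_compat_r; [apply pow_le, Cmod_ge_0|apply Hub].
- exists l. apply is_Cpseries_iff. exact Hl.
Qed.

(** Second-order Taylor remainder of a monomial. The factor n (n - 1) r^(n-2), with n = k + 2, is
    twice the sharp one, but it is exactly the factor produced by differentiating a power series
    twice. *)
Lemma Cpow_diff_bound (y z : C) (r : R) (k : nat) :
  (Cmod y <= r)%R -> (Cmod z <= r)%R ->
  (Cmod (y ^ S (S k) - z ^ S (S k) - (y - z) * (z ^ S k * INR (S (S k))))
   <= INR (S k) * INR (S (S k)) * r ^ k * Cmod (y - z) ^ 2)%R.
Proof.
intros Hy Hz. induction k.
- replace (y ^ 2 - z ^ 2 - (y - z) * (z ^ 1 * INR 2)) with ((y - z) ^ 2).
  + rewrite Cmod_pow. simpl. pose proof (pow2_ge_0 (Cmod (y - z))) as H. simpl in H. lra.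
  + simpl. rewrite RtoC_plus. ring.
- set (E := y ^ S (S k) - z ^ S (S k) - (y - z) * (z ^ S k * INR (S (S k)))) in IHk.
  (* With E_n the remainder of degree n, the recursion is E_(n+1) = y E_n + n z^(n-1) (y - z)^2. *)
  replace (y ^ S (S (S k)) - z ^ S (S (S k)) - (y - z) * (z ^ S (S k) * INR (S (S (S k)))))
    with (y * E + INR (S (S k)) * (z ^ S k * (y - z) ^ 2)).
  + eapply Rle_trans; [apply Cmod_triangle|].
    rewrite !Cmod_mult, !Cmod_pow, Cmod_R, (Rabs_pos_eq (INR _)) by apply pos_INR.
    set (w := Cmod (y - z)) in *.
    assert (A : (Cmod y * Cmod E <= r * (INR (S k) * INR (S (S k)) * r ^ k * w ^ 2))%R).
    { apply Rmult_le_compat; auto using Cmod_ge_0. }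
    assert (B : (Cmod z ^ S k <= r ^ S k)%R) by (apply pow_incr; split; auto using Cmod_ge_0).
    assert (B' : (INR (S (S k)) * (Cmod z ^ S k * w ^ 2) <= INR (S (S k)) * (r ^ S k * w ^ 2))%R).
    { apply Rmult_le_compat_l; [apply pos_INR|]. apply Rmult_le_compat_r; [apply pow2_ge_0|exact B]. }
    assert (P : (0 <= r ^ S k * w ^ 2)%R).
    { apply Rmult_le_pos; [|apply pow2_ge_0]. apply pow_le. pose proof (Cmod_ge_0 z); lra. }
    rewrite !S_INR in *. simpl in *. pose proof (pos_INR k). nra.
  + unfold E. rewrite !S_INR, !RtoC_plus. simpl. ring.
Qed.

(** Summing the monomial remainders bounds the total error by M |y - z|^2, where M is the second
    derivative of the series of moduli at a radius r strictly between |z| and 1. *)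
Lemma is_derive_Cpseries (u : nat -> C) (h h' : C -> C) :
  (forall z, in_U z -> is_Cpseries u z (h z)) ->
  (forall z, in_U z -> is_Cpseries (fun k => INR (S k) * u (S k)) z (h' z)) ->
  forall z, in_U z -> @is_derive C_AbsRing C_NormedModule h z (h' z).
Proof.
intros Hh Hh' z Hz.
assert (Hb : Rbar_le 1 (CV_radius (fun k => Cmod (u k)))).
{ apply CV_radius_Cmod. intros y Hy. exists (h y). auto. }
set (b := fun k => Cmod (u k)) in Hb.
set (r := ((1 + Cmod z) / 2)%R).
pose proof (Cmod_ge_0 z) as Hz0. unfold in_U in Hz.
assert (Hr : (Cmod z < r < 1)%R) by (unfold r; lra).
assert (HM : ex_series (fun k => (PS_derive (PS_derive b) k * r ^ k)%R)).
{ apply ex_pseries_R, CV_radius_inside. rewrite !CV_radius_derive.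
  eapply Rbar_lt_le_trans; [|exact Hb]. simpl. rewrite Rabs_pos_eq; lra. }
apply Series_correct in HM. set (M := Series _) in HM.
assert (K : forall y, (Cmod y < r)%R ->
  (Cmod (h y - h z - (y - z) * h' z) <= M * Cmod (y - z) ^ 2)%R).
{ intros y Hy.
  (* The series of [h' z] moved by one place, with 0 in front, lines up with the series of [h]. *)
  set (e := fun k => match k with O => RtoC 0 | S j => z ^ j * (INR (S j) * u (S j)) end).
  assert (He : is_Cseries e (h' z)).
  { apply is_series_decr_1.
    match goal with |- is_series _ ?l =>
      replace l with (h' z) by (change (h' z = h' z + - 0); ring) end.
    apply is_Cpseries_iff, Hh'. exact Hz. }
  assert (Ha : is_Cseries (fun k => y ^ k * u k - z ^ k * u k - (y - z) * e k)
                 (h y - h z - (y - z) * h' z)).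
  { apply (is_series_minus (K := C_AbsRing) (V := C_NormedModule)).
    - apply (is_series_minus (K := C_AbsRing) (V := C_NormedModule));
        apply is_Cpseries_iff, Hh; unfold in_U; lra.
    - exact (is_series_scal (K := C_AbsRing) (V := C_NormedModule) (y - z) e _ He). }
  (* The remainders of degree 0 and 1 vanish, hence the two leading zeros. *)
  set (c := fun k => match k with S (S j) =>
       (PS_derive (PS_derive b) j * r ^ j * Cmod (y - z) ^ 2)%R | _ => 0%R end).
  assert (Hc : is_series c (M * Cmod (y - z) ^ 2)%R).
  { apply is_series_decr_1, is_series_decr_1. simpl.
    replace (plus _ _) with (M * Cmod (y - z) ^ 2)%R
      by (unfold plus, opp; simpl; ring).
    apply (is_series_scal_r (Cmod (y - z) ^ 2) _ _ HM). }
  refine (is_Cseries_norm_le _ _ _ _ Ha _ Hc).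
  intros [|[|j]]; cbv beta iota delta [e c].
  - replace (_ - _ - _) with (RtoC 0) by (simpl; ring). rewrite Cmod_0. lra.
  - replace (_ - _ - _) with (RtoC 0) by (simpl; ring). rewrite Cmod_0. lra.
  - replace (y ^ S (S j) * u (S (S j)) - z ^ S (S j) * u (S (S j)) -
       (y - z) * (z ^ S j * (INR (S (S j)) * u (S (S j)))))
    with ((y ^ S (S j) - z ^ S (S j) - (y - z) * (z ^ S j * INR (S (S j)))) * u (S (S j)))
    by ring.
    rewrite Cmod_mult.
    eapply Rle_trans.
    + apply Rmult_le_compat_r; [apply Cmod_ge_0|].
      apply (Cpow_diff_bound y z r); lra.
    + apply Req_le. unfold PS_derive, b. ring. }
apply is_derive_C_iff. intros eps Heps.
exists (Rmin (r - Cmod z) (eps / (Rabs M + 1)))%R. split.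
{ pose proof (Rabs_pos M). apply Rmin_pos; [lra|]. apply Rdiv_lt_0_compat; lra. }
intros y Hy.
pose proof (Rlt_le_trans _ _ _ Hy (Rmin_l _ _)) as H1.
pose proof (Rlt_le_trans _ _ _ Hy (Rmin_r _ _)) as H2.
eapply Rle_trans; [apply K|].
- replace y with (z + (y - z)) by ring. eapply Rle_lt_trans; [apply Cmod_triangle|]. lra.
- pose proof (Cmod_ge_0 (y - z)) as W.
  pose proof (Rle_abs M) as HM1. pose proof (Rabs_pos M) as HM0.
  assert (Rabs M * Cmod (y - z) <= eps)%R; [|nra].
  apply (Rmult_lt_compat_r (Rabs M + 1)) in H2; [|lra].
  replace (eps / (Rabs M + 1) * (Rabs M + 1))%R with eps in H2 by (field; lra). nra.
Qed.

(** Applied to f, this gives the leading behaviour of the integrand at 0; applied to the series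
    solution, it makes the antiderivative vanish there. *)
Lemma Cpseries_near_0 (p : nat) (u : nat -> C) (f : C -> C) :
  (forall k, (k < p)%nat -> u k = 0) -> u p = 1 ->
  (forall z, in_U z -> is_Cpseries u z (f z)) ->
  exists M : R, forall z, (Cmod z <= / 2)%R ->
    (Cmod (f z - z ^ p) <= M * Cmod z ^ S p)%R.
Proof.
intros H0 H1 Hf.
assert (Hb : Rbar_le 1 (CV_radius (fun k => Cmod (u k)))).
{ apply CV_radius_Cmod. intros y Hy. exists (f y). auto. }
set (b := fun k => Cmod (u k)) in Hb.
assert (HM : ex_series (fun k => (b k * (/ 2) ^ k)%R)).
{ apply ex_pseries_R, CV_radius_inside.
  eapply Rbar_lt_le_trans; [|exact Hb]. simpl. rewrite Rabs_pos_eq; lra. }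
apply (ex_series_incr_n _ (S p)) in HM.
apply Series_correct in HM. set (M := Series _) in HM.
(* [M] sums the tail at radius 1/2, including its factor (1/2)^(p+1); the power of 2 removes that
   factor so that |z|^(p+1) can replace it. *)
exists (M * 2 ^ S p)%R. intros z Hz.
assert (HU : in_U z) by (unfold in_U; lra).
set (a := fun k => z ^ k * u k).
assert (Hs : forall n, (n <= p)%nat -> @eq C (sum_n a n) (if Nat.eq_dec n p then z ^ p else RtoC 0)).
{ induction n; intros Hn.
  - rewrite sum_O. unfold a. destruct (Nat.eq_dec 0 p) as [E|E].
    + subst p. rewrite H1. ring.
    + rewrite H0 by lia. ring.
  - rewrite sum_Sn, IHn by lia. destruct (Nat.eq_dec n p) as [E|E]; [lia|].
    change (0 + a (S n) = if Nat.eq_dec (S n) p then z ^ p else RtoC 0). unfold a.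
    destruct (Nat.eq_dec (S n) p) as [E'|E'].
    + rewrite E', H1. ring.
    + rewrite H0 by lia. ring. }
assert (Ha : is_Cseries (fun k => a (S p + k)%nat) (f z - z ^ p)).
{ apply is_series_incr_n; [lia|]. simpl pred. rewrite Hs by lia.
  destruct (Nat.eq_dec p p) as [_|E]; [|lia].
  replace (plus _ _) with (f z) by (change (f z = f z - z ^ p + z ^ p); ring).
  apply is_Cpseries_iff, Hf, HU. }
assert (HM' := is_series_scal_r (2 ^ S p * Cmod z ^ S p) _ _ HM).
rewrite <- Rmult_assoc in HM'.
refine (is_Cseries_norm_le _ _ _ _ Ha _ HM').
intros k. unfold a. rewrite Cmod_mult, Cmod_pow, pow_add.
fold (b (S p + k)%nat).
replace (b (S p + k)%nat * (/ 2) ^ (S p + k) * (2 ^ S p * Cmod z ^ S p))%R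
  with (Cmod z ^ S p * (/ 2) ^ k * b (S p + k)%nat)%R.
- apply Rmult_le_compat_r; [apply Cmod_ge_0|].
  apply Rmult_le_compat_l; [apply pow_le, Cmod_ge_0|].
  apply pow_incr. split; [apply Cmod_ge_0|exact Hz].
- rewrite pow_add. rewrite (pow_inv 2 (S p)). field. apply pow_nonzero. lra.
Qed.

(** * Integrals of complex functions of a real variable *)

Notation is_CRInt := (@is_RInt C_R_NormedModule).

Lemma is_derive_RC_const (k : C) (s : R) : is_derive_RC (fun _ => k) s 0.
Proof. split; apply @is_derive_const. Qed.

Lemma is_derive_RC_continuous (g : R -> C) (s : R) (l : C) : is_derive_RC g s l ->
  @continuous R_UniformSpace R_UniformSpace (fun t => Re (g t)) s /\
  @continuous R_UniformSpace R_UniformSpace (fun t => Im (g t)) s.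
Proof.
intros [H1 H2]; split; apply (@ex_derive_continuous R_AbsRing R_NormedModule);
  eexists; eassumption.
Qed.

Lemma is_CRInt_derive (A g : R -> C) (a b : R) :
  (a <= b)%R ->
  (forall s, (a <= s <= b)%R -> is_derive_RC A s (g s)) ->
  (forall s, (a <= s <= b)%R -> exists l, is_derive_RC g s l) ->
  is_CRInt g a b (A b - A a).
Proof.
intros Hab HA Hg.
assert (Hb : forall s, (Rmin a b <= s <= Rmax a b)%R -> (a <= s <= b)%R).
{ intros s. rewrite Rmin_left, Rmax_right by assumption. auto. }
assert (H : is_CRInt g a b (minus (Re (A b)) (Re (A a)), minus (Im (A b)) (Im (A a)))).
{ apply (is_RInt_fct_extend_pair (U := R_NormedModule) (V := R_NormedModule)).
  - apply (is_RInt_derive (fun t => Re (A t))); intros s Hs; apply Hb in Hs.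
    + apply HA, Hs.
    + destruct (Hg s Hs) as [l Hl]. apply (is_derive_RC_continuous _ _ _ Hl).
  - apply (is_RInt_derive (fun t => Im (A t))); intros s Hs; apply Hb in Hs.
    + apply HA, Hs.
    + destruct (Hg s Hs) as [l Hl]. apply (is_derive_RC_continuous _ _ _ Hl). }
exact H.
Qed.

(** * The improper integral along a segment *)

Lemma Cmod_le_Re_Im (z : C) : (Cmod z <= Rabs (Re z) + Rabs (Im z))%R.
Proof.
replace z with (RtoC (Re z) + Ci * RtoC (Im z)) at 1
  by (destruct z; unfold Ci, RtoC, Cplus, Cmult; simpl; f_equal; ring).
eapply Rle_trans; [apply Cmod_triangle|].
rewrite Cmod_mult, !Cmod_R.
replace (Cmod Ci) with 1%R; [lra|].
unfold Cmod, Ci; simpl. rewrite <- sqrt_1 at 1. f_equal. ring.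
Qed.

(** The product [cpower z (c - INR p - 1) * z] contained in [segment_integrand] is merged into the
    constant [cpower z (c - INR p)]; only a power of the real variable remains singular. *)
Definition integrand (p : nat) (c : C) (f : C -> C) (z : C) (s : R) : C :=
  rpow s (c - INR p - 1) * (cpower z (c - INR p) * f (s * z)).

Lemma segment_integrand_eq (p : nat) (c : C) (f : C -> C) (z : C) (s : R) :
  z <> 0 -> (0 < s)%R -> segment_integrand p c f z s = integrand p c f z s.
Proof.
intros Hz Hs. unfold segment_integrand, integrand.
rewrite cpower_scale by assumption.
replace (cpower z (c - INR p)) with (cpower z (c - INR p - 1 + 1)) by (f_equal; ring).
rewrite cpower_succ by assumption. ring.
Qed.

Lemma in_U_segment (z : C) (s : R) : in_U z -> (0 <= s <= 1)%R -> in_U (s * z).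
Proof.
unfold in_U. intros Hz Hs. rewrite Cmod_mult, Cmod_R, Rabs_pos_eq by lra.
pose proof (Cmod_ge_0 z). nra.
Qed.

Lemma is_derive_RC_integrand (p : nat) (c : C) (f : C -> C) (z : C) (s : R) :
  analytic_in_U f -> in_U z -> (0 < s <= 1)%R ->
  exists l, is_derive_RC (integrand p c f z) s l.
Proof.
intros Hf Hz Hs.
destruct (Hf (s * z)) as [d Hd]; [apply in_U_segment; [assumption|lra]|].
eexists. apply is_derive_RC_mult; [apply is_derive_rpow; lra|].
apply is_derive_RC_mult; [apply is_derive_RC_const|].
apply is_derive_RC_comp. exact Hd.
Qed.

Lemma is_segment_integral_iff (p : nat) (c : C) (f : C -> C) (z l : C) :
  z <> 0 ->
  @is_RInt_gen C_R_NormedModule (segment_integrand p c f z) (at_right 0) (at_point 1) l <->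
  forall eps : R, (0 < eps)%R -> exists delta : R, (0 < delta)%R /\
    forall s : R, (0 < s < delta)%R -> exists y : C,
      is_CRInt (integrand p c f z) s 1 y /\ (Cmod (y - l) < eps)%R.
Proof.
intros Hz. split.
- intros H eps Heps.
  (* Balls of [C_R_NormedModule] are componentwise, so each component receives half of the
     tolerance. *)
  assert (Heps2 : (0 < eps / 2)%R) by lra.
  destruct (H (fun y => @ball C_R_NormedModule l (mkposreal _ Heps2) y)) as [Q R HQ HR HQR].
  { exists (mkposreal _ Heps2). auto. }
  destruct HQ as [del Hdel].
  exists (Rmin del 1). split; [apply Rmin_pos; [apply cond_pos|lra]|].
  intros s [Hs1 Hs2].
  pose proof (Rlt_le_trans _ _ _ Hs2 (Rmin_l _ _)) as H1.
  pose proof (Rlt_le_trans _ _ _ Hs2 (Rmin_r _ _)) as H2.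
  destruct (HQR s 1%R) as [y [Hy1 Hy2]].
  + apply Hdel; [|assumption].
    change (Rabs (s - 0) < del)%R. rewrite Rminus_0_r, Rabs_pos_eq; lra.
  + exact HR.
  + exists y. split.
    * refine (is_RInt_ext _ _ _ _ _ _ Hy1). simpl. rewrite Rmin_left, Rmax_right by lra.
      intros x Hx. apply segment_integrand_eq; [assumption|lra].
    * eapply Rle_lt_trans; [apply Cmod_le_Re_Im|].
      destruct Hy2 as [B1 B2].
      change (Rabs (fst y - fst l) < eps / 2)%R in B1.
      change (Rabs (snd y - snd l) < eps / 2)%R in B2.
      unfold Re, Im; simpl. unfold Rminus in *. lra.
- intros H P [eps HP].
  destruct (H eps (cond_pos eps)) as (del & Hdel & Hs).
  assert (Hdel' : (0 < Rmin del 1)%R) by (apply Rmin_pos; lra).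
  exists (fun s => (0 < s < Rmin del 1)%R) (fun t => t = 1%R).
  + exists (mkposreal _ Hdel'). intros s B Hs0.
    change (Rabs (s - 0) < Rmin del 1)%R in B.
    rewrite Rminus_0_r, Rabs_pos_eq in B by lra. lra.
  + reflexivity.
  + intros s t [Hs1 Hs2] ->.
    pose proof (Rlt_le_trans _ _ _ Hs2 (Rmin_l _ _)) as H1.
    pose proof (Rlt_le_trans _ _ _ Hs2 (Rmin_r _ _)) as H2.
    destruct (Hs s) as (y & Hy1 & Hy2); [lra|].
    exists y. split.
    * refine (is_RInt_ext _ _ _ _ _ _ Hy1). simpl. rewrite Rmin_left, Rmax_right by lra.
      intros x Hx. symmetry. apply segment_integrand_eq; [assumption|lra].
    * apply HP. split.
      -- eapply Rle_lt_trans; [apply (re_le_Cmod (y - l))|exact Hy2].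
      -- eapply Rle_lt_trans; [apply (Im_le_Cmod (y - l))|exact Hy2].
Qed.

Lemma is_derive_RC_RInt_lower (g J : R -> C) (s b : R) :
  (exists delta : R, (0 < delta)%R /\
    forall t : R, (Rabs (t - s) < delta)%R -> is_CRInt g t b (J t)) ->
  (exists l, is_derive_RC g s l) ->
  is_derive_RC J s (- g s).
Proof.
intros (del & Hdel & HJ) [l Hl].
destruct (is_derive_RC_continuous _ _ _ Hl) as [C1 C2].
split.
- apply (is_derive_RInt' (fun t => Re (g t)) (fun t => Re (J t)) s b); [|exact C1].
  exists (mkposreal _ Hdel). intros t Ht.
  exact (is_RInt_fct_extend_fst (U := R_NormedModule) (V := R_NormedModule) _ _ _ _ (HJ t Ht)).
- apply (is_derive_RInt' (fun t => Im (g t)) (fun t => Im (J t)) s b); [|exact C2].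
  exists (mkposreal _ Hdel). intros t Ht.
  exact (is_RInt_fct_extend_snd (U := R_NormedModule) (V := R_NormedModule) _ _ _ _ (HJ t Ht)).
Qed.

Lemma is_derive_RC_minus_const (g : R -> C) (k : C) (s : R) (l : C) :
  is_derive_RC g s l -> is_derive_RC (fun t => g t - k) s l.
Proof.
intros [H1 H2]; split.
- apply (is_derive_ext (fun t => minus (Re (g t)) (Re k))); [reflexivity|].
  replace (Re l) with (minus (Re l) 0%R) by (unfold minus, plus, opp; simpl; ring).
  apply @is_derive_minus; [exact H1|apply @is_derive_const].
- apply (is_derive_ext (fun t => minus (Im (g t)) (Im k))); [reflexivity|].
  replace (Im l) with (minus (Im l) 0%R) by (unfold minus, plus, opp; simpl; ring).
  apply @is_derive_minus; [exact H2|apply @is_derive_const].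
Qed.

Lemma Cpow_mult (x y : C) (n : nat) : (x * y) ^ n = x ^ n * y ^ n.
Proof. induction n; simpl; [ring|]. rewrite IHn. ring. Qed.

(* Suppose [Re c <= 0] and let [J s], the integral from [s] to [1], tend to [l] as
   [s -> 0].  Then [W s = s ^ (- c) (J s - l) / k] tends to [0], whereas
   [s * W' s] tends to [- 1], so that [W e - W (2 e)] stays away from [0].  This
   covers the oscillating case [Re c = 0] and the resonances [c = 0, -1, ...]
   uniformly. *)
Lemma segment_integral_Re_pos (p : nat) (c : C) (f : C -> C) (z : C) (M : R) :
  analytic_in_U f ->
  (forall t, (Cmod t <= / 2)%R -> (Cmod (f t - t ^ p) <= M * Cmod t ^ S p)%R) ->
  in_U z -> z <> 0 -> ex_segment_integral p c f z -> (0 < Re c)%R.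
Proof.
intros Hf HM HzU Hz [l Hl0].
pose proof (proj1 (is_segment_integral_iff p c f z l Hz) Hl0) as Hl.
change C in l. clear Hl0.
destruct (Rlt_le_dec 0 (Re c)) as [|Hc]; [assumption|exfalso].
pose proof (HzU) as HzU'. unfold in_U in HzU'.
set (g := integrand p c f z) in *.
(* [k] is the leading coefficient at 0: g(s) behaves like k s^(c-1). *)
set (k := cpower z (c - INR p) * z ^ p).
assert (Hk : k <> 0).
{ apply Cmult_neq_0; [apply cpower_neq_0; assumption|].
  apply Cpow_nz. assumption. }
pose proof (proj1 (Cmod_gt_0 k) Hk) as Hk0.
pose proof (Cmod_ge_0 c) as Hc0.
(* The tolerance is chosen so that both [W s] and [c * W s] below are at most 1/16 in modulus. *)
destruct (Hl (Cmod k / (16 * (1 + Cmod c)))%R) as (del & Hdel & HJ0).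
{ apply Rdiv_lt_0_compat; lra. }
set (J := fun s : R => RInt (V := C_R_CompleteNormedModule) g s 1).
assert (HJ : forall s, (0 < s < del)%R ->
  is_CRInt g s 1 (J s) /\ (Cmod ((J s - l) / k) <= / (16 * (1 + Cmod c)))%R).
{ intros s Hs. destruct (HJ0 s Hs) as (y & Hy1 & Hy2).
  assert (E : J s = y) by exact (is_RInt_unique (V := C_R_CompleteNormedModule) g s 1 y Hy1).
  rewrite E. split; [assumption|].
  rewrite Cmod_div by assumption.
  apply (Rmult_le_reg_r (Cmod k)); [assumption|].
  replace (Cmod (y - l) / Cmod k * Cmod k)%R with (Cmod (y - l)) by (field; lra).
  replace (/ (16 * (1 + Cmod c)) * Cmod k)%R with (Cmod k / (16 * (1 + Cmod c)))%R by (field; lra).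
  lra. }
clearbody J. clear HJ0 Hl.
set (W := fun s => rpow s (- c) * ((J s - l) * / k)).
set (N := fun s => - c * rpow s (- c - 1) * ((J s - l) * / k)
                   + rpow s (- c) * (- g s * / k + (J s - l) * 0)).
assert (HW : forall s, (0 < s < del)%R -> (s <= 1)%R -> is_derive_RC W s (N s)).
{ intros s Hs Hs1. apply is_derive_RC_mult; [apply is_derive_rpow; lra|].
  apply (is_derive_RC_mult (fun t => J t - l) (fun _ => / k)); [|apply is_derive_RC_const].
  apply is_derive_RC_minus_const. apply (is_derive_RC_RInt_lower g J s 1).
  - exists (Rmin s (del - s)). split; [apply Rmin_pos; lra|].
    intros t Ht.
    pose proof (Rlt_le_trans _ _ _ Ht (Rmin_l _ _)) as H1.
    pose proof (Rlt_le_trans _ _ _ Ht (Rmin_r _ _)) as H2.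
    apply Rabs_lt_between in H1. apply Rabs_lt_between in H2. apply HJ. lra.
  - apply is_derive_RC_integrand; [assumption|assumption|lra]. }
(* The assumption [Re c <= 0] enters here: s^(-c) stays bounded near 0. *)
assert (Hpow : forall s, (0 < s <= 1)%R -> (Cmod (rpow s (- c)) <= 1)%R).
{ intros s Hs. rewrite Cmod_rpow, <- exp_0.
  assert (L : (ln s <= 0)%R) by (rewrite <- ln_1; apply ln_le; lra).
  apply Rnot_lt_le. intros K. apply exp_lt_inv in K. revert K. apply Rle_not_lt.
  replace (Re (- c)) with (- Re c)%R by reflexivity. nra. }
assert (HWb : forall s, (0 < s < del)%R -> (s <= 1)%R -> (Cmod (W s) <= / 16)%R).
{ intros s Hs Hs1. unfold W. rewrite Cmod_mult.
  destruct (HJ s Hs) as [_ B]. unfold Cdiv in B.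
  assert (B' : (/ (16 * (1 + Cmod c)) <= / 16)%R) by (apply Rinv_le_contravar; lra).
  pose proof (Hpow s ltac:(lra)). pose proof (Cmod_ge_0 ((J s - l) * / k)).
  pose proof (Cmod_ge_0 (rpow s (- c))). nra. }
assert (HN : forall s, (0 < s < del)%R -> (s <= / 2)%R -> (Rabs M * s <= / 4)%R ->
  (s * Re (N s) <= - / 2)%R).
{ intros s Hs Hs1 HsM.
  assert (Hs0 : RtoC s <> 0) by (intros E; apply RtoC_inj in E; lra).
  assert (Hzp : z ^ p <> 0) by (apply Cpow_nz; assumption).
  assert (Hsp : RtoC s ^ p <> 0) by (apply Cpow_nz; assumption).
  assert (Hr1 : rpow s (- c) = rpow s (- c - 1) * s).
  { rewrite <- (rpow_1 s) by lra. rewrite <- rpow_plus. f_equal. ring. }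
  assert (Hr2 : rpow s (- c) * rpow s (c - INR p - 1) * s * s ^ p = 1).
  { rewrite <- rpow_nat by lra. rewrite <- (rpow_1 s) by lra.
    rewrite <- !rpow_plus. rewrite <- (rpow_0 s). f_equal. ring. }
  (* That is, s W' = -1 - (relative error of f at s z) - c W. The last two terms are at most 1/4 and
     1/16 in modulus, which leaves a real part below -1/2. *)
  assert (E : s * N s = - 1 - (f (s * z) - (s * z) ^ p) / (s * z) ^ p
                        - c * rpow s (- c) * ((J s - l) / k)).
  { unfold N, g, integrand.
    rewrite Cpow_mult.
    transitivity (- c * (rpow s (- c - 1) * s) * ((J s - l) / k)
      - (rpow s (- c) * rpow s (c - INR p - 1) * s * s ^ p) *
        (f (s * z) / (s ^ p * z ^ p))).
    - unfold k, Cdiv. field. repeat split; auto. apply cpower_neq_0; assumption.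
    - rewrite Hr2, <- Hr1. unfold Cdiv. field. repeat split; auto. }
  assert (E' : (s * Re (N s) = Re (s * N s))%R) by (unfold Re; simpl; ring).
  rewrite E', E. clear E E' Hr1 Hr2.
  set (r := (f (s * z) - (s * z) ^ p) / (s * z) ^ p).
  set (q := c * rpow s (- c) * ((J s - l) / k)).
  assert (Hsz : s * z <> 0) by (apply Cmult_neq_0; assumption).
  pose proof (proj1 (Cmod_gt_0 _) Hsz) as Hsz0.
  assert (Hszm : (Cmod (s * z) <= s)%R).
  { rewrite Cmod_mult, Cmod_R, Rabs_pos_eq by lra. pose proof (Cmod_ge_0 z). nra. }
  assert (Hr : (Cmod r <= / 4)%R).
  { unfold r. rewrite Cmod_div by (apply Cpow_nz; assumption).
    rewrite Cmod_pow.
    pose proof (pow_lt _ p Hsz0) as P.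
    apply (Rmult_le_reg_r (Cmod (s * z) ^ p)); [assumption|].
    unfold Rdiv. rewrite Rmult_assoc, Rinv_l, Rmult_1_r by lra.
    eapply Rle_trans; [apply HM; lra|].
    simpl. rewrite <- Rmult_assoc. apply Rmult_le_compat_r; [lra|].
    pose proof (Rle_abs M). pose proof (Rabs_pos M). nra. }
  assert (Hq : (Cmod q <= / 16)%R).
  { unfold q. rewrite !Cmod_mult. destruct (HJ s Hs) as [_ B].
    pose proof (Hpow s ltac:(lra)) as B2. pose proof (Cmod_ge_0 (rpow s (- c))).
    pose proof (Cmod_ge_0 ((J s - l) / k)).
    eapply Rle_trans with (Cmod c * / (16 * (1 + Cmod c)))%R.
    - rewrite Rmult_assoc. apply Rmult_le_compat_l; [assumption|]. nra.
    - apply (Rmult_le_reg_r (16 * (1 + Cmod c))); [lra|].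
      rewrite Rmult_assoc, Rinv_l by lra. lra. }
  pose proof (re_le_Cmod r) as R1. pose proof (re_le_Cmod q) as R2.
  apply Rabs_le_between in R1. apply Rabs_le_between in R2.
  replace (Re (- 1 - r - q)) with (- 1 - Re r - Re q)%R by (unfold Re; simpl; ring).
  lra. }
pose proof (Rabs_pos M) as HM0.
set (s0 := Rmin del (Rmin (/ 2) (/ (4 * (Rabs M + 1))))).
assert (Hs0 : (0 < s0)%R).
{ repeat apply Rmin_pos; try lra. apply Rinv_0_lt_compat; lra. }
assert (Hs0' : (s0 <= del /\ s0 <= / 2 /\ Rabs M * s0 <= / 4)%R).
{ unfold s0. pose proof (Rmin_l del (Rmin (/ 2) (/ (4 * (Rabs M + 1))))).
  pose proof (Rmin_r del (Rmin (/ 2) (/ (4 * (Rabs M + 1))))).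
  pose proof (Rmin_l (/ 2) (/ (4 * (Rabs M + 1)))).
  pose proof (Rmin_r (/ 2) (/ (4 * (Rabs M + 1)))).
  repeat split; try lra.
  fold s0 in H, H0 |- *.
  assert (s0 <= / (4 * (Rabs M + 1)))%R as L by lra.
  apply (Rmult_le_compat_r (4 * (Rabs M + 1))) in L; [|lra].
  rewrite Rinv_l in L by lra. nra. }
destruct Hs0' as (K1 & K2 & K3). clearbody s0.
set (e := (s0 / 4)%R).
assert (He : forall s, (e <= s <= 2 * e)%R -> (0 < s < del /\ s <= / 2 /\ Rabs M * s <= / 4)%R).
{ unfold e. intros s Hs. repeat split; try lra. nra. }
(* The increment of [Re (W s)] over [e, 2e] is e Re (N x) with x <= 2e, hence at most -1/4; the
   bound 1/16 at both ends only allows a drop of 1/8. *)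
destruct (MVT_gen (fun s => Re (W s)) e (2 * e) (fun s => Re (N s))) as (x & Hx & Hmvt).
{ intros s. unfold e. rewrite Rmin_left, Rmax_right by lra. intros Hs.
  apply HW; lra. }
{ intros s. unfold e. rewrite Rmin_left, Rmax_right by lra. intros Hs.
  apply continuity_pt_filterlim. apply (is_derive_RC_continuous W s (N s)). apply HW; lra. }
rewrite Rmin_left, Rmax_right in Hx by (unfold e; lra).
destruct (He x Hx) as (X1 & X2 & X3).
pose proof (HN x X1 X2 X3) as HNx.
assert (e2 : (e <= 2 * e)%R) by (unfold e; lra).
destruct (He e ltac:(lra)) as (Y1 & Y2 & _).
destruct (He (2 * e)%R ltac:(lra)) as (Z1 & Z2 & _).
pose proof (HWb e Y1 ltac:(lra)) as W1. pose proof (HWb (2 * e)%R Z1 ltac:(lra)) as W2.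
pose proof (re_le_Cmod (W e)) as V1. pose proof (re_le_Cmod (W (2 * e)%R)) as V2.
apply Rabs_le_between in V1. apply Rabs_le_between in V2.
assert (e * Re (N x) <= - / 4)%R.
{ assert (Re (N x) < 0)%R by nra. nra. }
lra.
Qed.

Lemma segment_integral_value (p : nat) (c : C) (f h h' : C -> C) (z : C) (M : R) :
  (0 < Re c)%R -> analytic_in_U f ->
  (forall t, in_U t -> @is_derive C_AbsRing C_NormedModule h t (h' t)) ->
  (forall t, in_U t -> t * h' t = c * f t - (c - INR p) * h t) ->
  (forall t, (Cmod t <= / 2)%R -> (Cmod (h t - t ^ p) <= M * Cmod t ^ S p)%R) ->
  in_U z -> z <> 0 ->
  segment_integral p c f z = cpower z (c - INR p) / c * h z.
Proof.
intros Hc Hf Hh Heq HM HzU Hz.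
assert (Hc0 : c <> 0) by (intros E; rewrite E in Hc; simpl in Hc; lra).
(* By the equation for h, the derivative of s^(c-p) h(s z) is c s^(c-p-1) f(s z); dividing by c and
   restoring the branch factor gives [integrand]. *)
set (w := cpower z (c - INR p) / c).
set (A := fun s : R => w * (rpow s (c - INR p) * h (s * z))).
apply (is_RInt_gen_unique (V := C_R_CompleteNormedModule)).
apply is_segment_integral_iff; [assumption|].
intros eps Heps.
pose proof HzU as HzU'. unfold in_U in HzU'.
pose proof (Cmod_ge_0 w) as Hw0. pose proof (Rabs_pos M) as HM0.
set (eta := (eps / ((Cmod w + 1) * (1 + Rabs M)))%R).
assert (Heta : (0 < eta)%R) by (apply Rdiv_lt_0_compat; nra).
(* The second bound is eta^(1 / Re c): below it, |s^c| = s^(Re c) < eta. *)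
exists (Rmin (/ 2) (exp (ln eta / Re c))). split.
{ apply Rmin_pos; [lra|apply exp_pos]. }
intros s [Hs1 Hs2].
pose proof (Rlt_le_trans _ _ _ Hs2 (Rmin_l _ _)) as H1.
pose proof (Rlt_le_trans _ _ _ Hs2 (Rmin_r _ _)) as H2.
exists (A 1%R - A s). split.
- apply is_CRInt_derive; [lra| |].
  + intros t Ht.
    assert (HtU : in_U (t * z)) by (apply in_U_segment; [assumption|lra]).
    assert (E : integrand p c f z t = 0 * (rpow t (c - INR p) * h (t * z)) +
       w * ((c - INR p) * rpow t (c - INR p - 1) * h (t * z) + rpow t (c - INR p) * (z * h' (t * z)))).
    { replace (rpow t (c - INR p)) with (rpow t (c - INR p - 1) * t)
        by (rewrite <- (rpow_1 t) by lra; rewrite <- rpow_plus; f_equal; ring).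
      transitivity (w * rpow t (c - INR p - 1) * ((c - INR p) * h (t * z) + t * z * h' (t * z))).
      - rewrite Heq by assumption. unfold integrand, w. field. assumption.
      - ring. }
    rewrite E.
    apply is_derive_RC_mult; [apply is_derive_RC_const|].
    apply is_derive_RC_mult; [apply is_derive_rpow; lra|].
    apply is_derive_RC_comp, Hh, HtU.
  + intros t Ht. apply is_derive_RC_integrand; [assumption|assumption|lra].
- replace (A 1%R - A s - w * h z) with (- A s)
    by (unfold A; rewrite rpow_base1, Cmult_1_l; replace (1 * z) with z by ring; ring).
  rewrite Cmod_opp. unfold A. rewrite !Cmod_mult.
  set (t := s * z).
  set (d := Cmod t).
  assert (Hd : (0 <= d <= s)%R).
  { unfold d, t. split; [apply Cmod_ge_0|]. rewrite Cmod_mult, Cmod_R, Rabs_pos_eq by lra.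
    pose proof (Cmod_ge_0 z). nra. }
  assert (Hh1 : (Cmod (h t) <= s ^ p * (1 + Rabs M))%R).
  { replace (h t) with ((h t - t ^ p) + t ^ p) by ring.
    eapply Rle_trans; [apply Cmod_triangle|]. rewrite Cmod_pow. fold d.
    assert (B : (Cmod (h t - t ^ p) <= M * d ^ S p)%R) by (apply HM; fold d; lra).
    assert (B2 : (d ^ p <= s ^ p)%R) by (apply pow_incr; lra).
    assert (B3 : (0 <= d ^ p)%R) by (apply pow_le; lra).
    assert (B4 : (M * d ^ S p <= Rabs M * s ^ p)%R).
    { simpl. pose proof (Rle_abs M).
      apply Rle_trans with (Rabs M * (d * d ^ p))%R.
      { apply Rmult_le_compat_r; [|assumption]. apply Rmult_le_pos; lra. }
      apply Rmult_le_compat_l; [assumption|]. nra. }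
    lra. }
  assert (Hr : (Cmod (rpow s (c - INR p)) * s ^ p < eta)%R).
  { replace (s ^ p)%R with (Cmod (rpow s (INR p)))
      by (rewrite rpow_nat, Cmod_pow, Cmod_R, Rabs_pos_eq by lra; reflexivity).
    rewrite <- Cmod_mult, <- rpow_plus. replace (c - INR p + INR p) with c by ring.
    rewrite Cmod_rpow, <- (exp_ln eta) by assumption. apply exp_increasing.
    apply ln_increasing in H2; [|assumption]. rewrite !ln_exp in H2.
    apply (Rmult_lt_compat_l (Re c)) in H2; [|assumption].
    replace (Re c * (ln eta / Re c))%R with (ln eta) in H2 by (field; lra). exact H2. }
  pose proof (Cmod_ge_0 (rpow s (c - INR p))) as Hr0.
  apply Rle_lt_trans with (Cmod w * ((Cmod (rpow s (c - INR p)) * s ^ p) * (1 + Rabs M)))%R.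
  + apply Rmult_le_compat_l; [assumption|]. rewrite Rmult_assoc.
    apply Rmult_le_compat_l; assumption.
  + set (q := (Cmod (rpow s (c - INR p)) * s ^ p)%R) in *.
    apply Rle_lt_trans with (Cmod w * (eta * (1 + Rabs M)))%R.
    * apply Rmult_le_compat_l; [assumption|]. apply Rmult_le_compat_r; lra.
    * apply Rlt_le_trans with ((Cmod w + 1) * (eta * (1 + Rabs M)))%R.
      { apply Rmult_lt_compat_r; nra. }
      unfold eta. apply Req_le. field. lra.
Qed.

(** * The integral operator as solution of the Euler equation *)

Lemma is_derive_ext_in_U (g h : C -> C) (z d : C) :
  (forall t, in_U t -> g t = h t) -> in_U z ->
  @is_derive C_AbsRing C_NormedModule g z d ->
  @is_derive C_AbsRing C_NormedModule h z d.
Proof.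
intros E Hz Hd. apply is_derive_C_iff. intros eps Heps.
destruct (proj1 (is_derive_C_iff _ _ _) Hd eps Heps) as (del & Hdel & Hy).
pose proof Hz as Hz'. unfold in_U in Hz'.
exists (Rmin del (1 - Cmod z)). split; [apply Rmin_pos; lra|].
intros y Y.
rewrite <- !E.
- apply Hy. eapply Rlt_le_trans; [exact Y|apply Rmin_l].
- assumption.
- unfold in_U. replace y with (z + (y - z)) by ring.
  eapply Rle_lt_trans; [apply Cmod_triangle|].
  pose proof (Rlt_le_trans _ _ _ Y (Rmin_r _ _)). lra.
Qed.

Lemma analytic_in_U_ext (g h : C -> C) :
  (forall z, in_U z -> g z = h z) -> analytic_in_U g -> analytic_in_U h.
Proof.
intros E Hg z Hz. destruct (Hg z Hz) as [d Hd]. exists d.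
exact (is_derive_ext_in_U g h z d E Hz Hd).
Qed.

(* The solution is the series with coefficients [c / (c + k - p) * u k]. *)
Lemma Cpseries_euler_solution (p : nat) (c : C) (f : C -> C) :
  (0 < Re c)%R -> class_A p f ->
  exists h h' : C -> C, class_A p h /\
    (forall t, in_U t -> @is_derive C_AbsRing C_NormedModule h t (h' t)) /\
    (forall t, in_U t -> t * h' t = c * f t - (c - INR p) * h t).
Proof.
intros Hc (Hf & u & H0 & H1 & Hu).
assert (Hc0 : c <> 0) by (intros E; rewrite E in Hc; simpl in Hc; lra).
(* From p on, no denominator vanishes and the multipliers are bounded by |c| / Re c. Below p a
   denominator may be 0, but there u k = 0. *)
assert (Hden : forall k, (p <= k)%nat -> (Re c <= Cmod (c + INR k - INR p))%R).
{ intros k Hk. eapply Rle_trans; [|apply re_le_Cmod].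
  eapply Rle_trans; [|apply Rle_abs]. unfold Re; simpl.
  pose proof (le_INR _ _ Hk). unfold Re in *; lra. }
assert (Hden0 : forall k, (p <= k)%nat -> c + INR k - INR p <> 0).
{ intros k Hk E. specialize (Hden k Hk). rewrite E, Cmod_0 in Hden. lra. }
set (v := fun k => c / (c + INR k - INR p) * u k).
set (b := fun k => Cmod (u k)).
assert (Hb : Rbar_le 1 (CV_radius b)) by (apply CV_radius_Cmod; eauto).
set (K := (Cmod c / Re c)%R).
assert (HK : (0 < K)%R).
{ apply Rdiv_lt_0_compat; [apply Cmod_gt_0; assumption|assumption]. }
assert (Hv : forall k, (Cmod (v k) <= K * b k)%R).
{ intros k. unfold v, b. destruct (le_lt_dec p k) as [Hk|Hk].
  - rewrite Cmod_mult, Cmod_div by auto.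
    apply Rmult_le_compat_r; [apply Cmod_ge_0|]. unfold K.
    apply Rmult_le_compat_l; [apply Cmod_ge_0|].
    apply Rinv_le_contravar; auto.
  - rewrite H0 by assumption. rewrite Cmult_0_r, Cmod_0. lra. }
assert (HKb : Rbar_le 1 (CV_radius (fun k => K * b k)%R)).
{ change (Rbar_le 1 (CV_radius (PS_scal K b))).
  rewrite CV_radius_scal by lra. exact Hb. }
(* Membership in the disc stands under the existential so that choice yields a total function. *)
assert (Hex : forall t, exists l : C, in_U t -> is_Cpseries v t l).
{ intros t. destruct (Rlt_dec (Cmod t) 1) as [Ht|Ht].
  - destruct (ex_Cpseries v _ Hv HKb t Ht) as [l Hl]. exists l; auto.
  - exists (RtoC 0). intros Ht'. contradiction. }
assert (Hex' : forall t, exists l : C, in_U t -> is_Cpseries (fun k => INR (S k) * v (S k)) t l).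
{ intros t. destruct (Rlt_dec (Cmod t) 1) as [Ht|Ht].
  - destruct (ex_Cpseries (fun k => INR (S k) * v (S k)) (PS_derive (fun k => K * b k)%R))
      with (z := t) as [l Hl]; auto; [| |exists l; auto].
    + intros k. rewrite Cmod_mult, Cmod_R, Rabs_pos_eq by apply pos_INR.
      apply Rmult_le_compat_l; [apply pos_INR|apply Hv].
    + rewrite CV_radius_derive. exact HKb.
  - exists (RtoC 0). intros Ht'. contradiction. }
apply functional_choice in Hex as [h Hh]. apply functional_choice in Hex' as [h' Hh'].
assert (HD := is_derive_Cpseries v h h' Hh Hh').
exists h, h'. split; [split|split].
- intros t Ht. exists (h' t). auto.
- exists v. split; [|split; [|exact Hh]].
  + intros k Hk. unfold v. rewrite H0 by assumption. ring.
  + unfold v. rewrite H1. field. auto.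
- exact HD.
- intros t Ht.
  assert (S1 : is_Cseries (fun k => t ^ k * (INR k * v k)) (t * h' t)).
  { apply is_series_decr_1.
    match goal with |- is_series _ ?l =>
      replace l with (t * h' t)
        by (change (t * h' t = t * h' t + - (1 * (INR 0 * v 0%nat))); simpl INR; ring) end.
    apply (is_series_ext (fun k => t * (t ^ k * (INR (S k) * v (S k))))).
    - intros k. rewrite Cmult_assoc. reflexivity.
    - apply (is_series_scal (K := C_AbsRing) (V := C_NormedModule) t).
      apply is_Cpseries_iff, Hh', Ht. }
  assert (S2 : is_Cseries (fun k => c * (t ^ k * u k) - (c - INR p) * (t ^ k * v k))
                (c * f t - (c - INR p) * h t)).
  { apply (is_series_minus (K := C_AbsRing) (V := C_NormedModule));
      apply (is_series_scal (K := C_AbsRing) (V := C_NormedModule)); apply is_Cpseries_iff;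
      [apply Hu|apply Hh]; exact Ht. }
  refine (is_Cseries_unique _ _ _ S1 _).
  refine (is_series_ext _ _ _ _ S2).
  intros k. match goal with |- ?x = ?y => change (@eq C x y) end.
  (* The coefficient identity is (c + k - p) v k = c u k. *)
  unfold v. destruct (le_lt_dec p k) as [Hk|Hk].
  + field. auto.
  + rewrite H0 by assumption. ring.
Qed.

Lemma integral_operator_spec (p : nat) (c : C) (f : C -> C) :
  (0 < p)%nat ->
  class_A p f ->
  (forall z, in_U z -> z <> 0 -> ex_segment_integral p c f z) ->
  c <> 0 /\ class_A p (integral_operator p c f) /\
  forall z, in_U z ->
    z * C_derive (integral_operator p c f) z
    = c * f z - (c - INR p) * integral_operator p c f z.
Proof.
intros Hp Hf Hex. set (F := integral_operator p c f).
pose proof Hf as (Hfa & u & Hu0 & Hu1 & Hu).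
destruct (Cpseries_near_0 p u f Hu0 Hu1 Hu) as [M HM].
(* The sign of [Re c] does not depend on z, so convergence at one nonzero test point suffices. *)
assert (Hhalf : in_U (/ 2)%R /\ RtoC (/ 2)%R <> 0).
{ split.
  - unfold in_U. rewrite Cmod_R, Rabs_pos_eq; lra.
  - intros E. apply RtoC_inj in E. lra. }
destruct Hhalf as [Hhalf Hhalf0].
assert (Hc : (0 < Re c)%R).
{ apply (segment_integral_Re_pos p c f (/ 2)%R M); auto. }
assert (Hc0 : c <> 0) by (intros E; rewrite E in Hc; simpl in Hc; lra).
destruct (Cpseries_euler_solution p c f Hc Hf) as (h & h' & Hh & Hd & Heq).
pose proof Hh as (Hha & v & Hv0 & Hv1 & Hv).
destruct (Cpseries_near_0 p v h Hv0 Hv1 Hv) as [M' HM'].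
assert (E : forall z, in_U z -> h z = F z).
{ intros z Hz. unfold F, integral_operator. destruct (Ceq_dec z 0) as [->|Hz0].
  (* At the origin F is 0 by convention, and h vanishes there because p > 0. *)
  - assert (B := HM' 0). rewrite Cmod_0 in B. specialize (B ltac:(lra)).
    replace (0 ^ p) with (RtoC 0) in B by (destruct p; [lia|simpl; ring]).
    simpl in B. rewrite Rmult_0_l, Rmult_0_r in B.
    replace (h 0 - 0) with (h 0) in B by ring.
    apply Cmod_eq_0. pose proof (Cmod_ge_0 (h 0)). lra.
  - rewrite (segment_integral_value p c f h h' z M') by auto.
    field. split; [|apply cpower_neq_0]; assumption. }
split; [assumption|]. split.
- split; [exact (analytic_in_U_ext h F E Hha)|].
  exists v. repeat split; auto. intros z Hz. rewrite <- E by assumption. auto.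
- intros z Hz. rewrite (is_C_derive_unique F z (h' z)) by (apply (is_derive_ext_in_U h); auto).
  rewrite <- E by assumption.
  apply Heq, Hz.
Qed.

(** * The shift of the operators and the transfer of subordination *)

Lemma is_derive_C_linear_combination (f g : C -> C) (a b z df dg : C) :
  @is_derive C_AbsRing C_NormedModule f z df ->
  @is_derive C_AbsRing C_NormedModule g z dg ->
  @is_derive C_AbsRing C_NormedModule (fun t => a * f t + b * g t) z (a * df + b * dg).
Proof.
rewrite !is_derive_C_iff. intros Hf Hg eps Heps.
pose proof (Cmod_ge_0 a) as Ha. pose proof (Cmod_ge_0 b) as Hb.
assert (Hk : (0 < eps / (Cmod a + Cmod b + 1))%R) by (apply Rdiv_lt_0_compat; lra).
destruct (Hf _ Hk) as (d1 & Hd1 & H1). destruct (Hg _ Hk) as (d2 & Hd2 & H2).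
exists (Rmin d1 d2). split; [apply Rmin_pos; assumption|]. intros y Hy.
specialize (H1 y (Rlt_le_trans _ _ _ Hy (Rmin_l _ _))).
specialize (H2 y (Rlt_le_trans _ _ _ Hy (Rmin_r _ _))).
replace (a * f y + b * g y - (a * f z + b * g z) - (y - z) * (a * df + b * dg))
  with (a * (f y - f z - (y - z) * df) + b * (g y - g z - (y - z) * dg)) by ring.
eapply Rle_trans; [apply Cmod_triangle|]. rewrite !Cmod_mult.
apply Rle_trans with ((Cmod a + Cmod b) * (eps / (Cmod a + Cmod b + 1) * Cmod (y - z)))%R.
- rewrite Rmult_plus_distr_r.
  apply Rplus_le_compat; apply Rmult_le_compat_l; assumption.
- rewrite <- Rmult_assoc. apply Rmult_le_compat_r; [apply Cmod_ge_0|].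
  apply (Rmult_le_reg_r (Cmod a + Cmod b + 1)); [lra|]. field_simplify; [|lra]. nra.
Qed.

(** The weights sum to 1, which preserves the leading coefficient 1; the weight c / p is the one
    needed for z F' / p. *)
Lemma class_A_affine_combination (p : nat) (f g : C -> C) (a : C) :
  class_A p f -> class_A p g -> class_A p (fun t => a * f t + (1 - a) * g t).
Proof.
intros (Hfa & u & Hu0 & Hu1 & Hu) (Hga & v & Hv0 & Hv1 & Hv). split.
- intros t Ht. destruct (Hfa t Ht) as [df Hdf]. destruct (Hga t Ht) as [dg Hdg].
  eexists. apply is_derive_C_linear_combination; eassumption.
- exists (fun k => a * u k + (1 - a) * v k). split; [|split].
  + intros k Hk. rewrite Hu0, Hv0 by assumption. ring.
  + rewrite Hu1, Hv1. ring.
  + intros t Ht. specialize (Hu t Ht). specialize (Hv t Ht).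
    apply is_Cpseries_iff in Hu. apply is_Cpseries_iff in Hv. apply is_Cpseries_iff.
    eapply is_series_ext;
      [|apply (is_series_plus (K := C_AbsRing) (V := C_NormedModule));
        apply (is_series_scal (K := C_AbsRing) (V := C_NormedModule)); [exact Hu|exact Hv]].
    intros k. change (a * (t ^ k * u k) + (1 - a) * (t ^ k * v k)
      = t ^ k * (a * u k + (1 - a) * v k)). ring.
Qed.

Lemma operator_integral_shift (p : nat) (I : C -> Prop) (alpha : C -> C)
  (L : C -> (C -> C) -> C -> C) (b : C) (f F : C -> C) :
  (0 < p)%nat -> class_O p I alpha L -> I b -> commutes_with_zderiv p (L b) ->
  alpha b <> 0 -> class_A p f -> class_A p F ->
  (forall z, in_U z -> z * C_derive F z = alpha b * f z - (alpha b - INR p) * F z) ->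
  forall z, in_U z -> L (b + 1) F z = L b f z.
Proof.
intros Hp (_ & Hlin & HO) Hb Hcomm Hc Hf HF HD z Hz.
set (c := alpha b) in *.
assert (Hp0 : RtoC (INR p) <> 0).
{ intros E. apply RtoC_inj in E. apply (not_0_INR p); [lia|exact E]. }
set (g := fun t => c / INR p * f t + (1 - c / INR p) * F t).
assert (Hg : class_A p g) by (apply class_A_affine_combination; assumption).
assert (H1 : INR p * L b g z = z * C_derive (L b F) z).
{ apply Hcomm; auto. intros t Ht. rewrite HD by assumption. unfold g. field. assumption. }
assert (H2 : L b g z = c / INR p * L b f z + (1 - c / INR p) * L b F z).
{ apply (proj2 (Hlin b Hb) f F g); auto. }
rewrite (HO b F Hb HF z Hz), H2 in H1. fold c in H1.
(* The contributions of L^b F on the two sides cancel, since p (1 - c/p) = p - c. *)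
assert (H3 : c * L (b + 1) F z = c * L b f z).
{ replace (c * L b f z) with
    (INR p * (c / INR p * L b f z + (1 - c / INR p) * L b F z) + (c - INR p) * L b F z)
    by (field; assumption).
  rewrite H1. ring. }
replace (L (b + 1) F z) with (/ c * (c * L (b + 1) F z)) by (field; assumption).
rewrite H3. field. assumption.
Qed.

(** The outer function is evaluated at w(z), which remains in the disc because |w(z)| <= |z|;
    agreement on the disc is therefore enough. *)
Lemma subordinate_ext (g g' h h' : C -> C) :
  (forall z, in_U z -> g z = g' z) -> (forall z, in_U z -> h z = h' z) ->
  subordinate g h -> subordinate g' h'.
Proof.
intros Eg Eh (Hg & Hh & w & [Hw Hwz] & E).
split; [exact (analytic_in_U_ext g g' Eg Hg)|].
split; [exact (analytic_in_U_ext h h' Eh Hh)|].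
exists w. split; [split; assumption|].
intros z Hz. rewrite <- Eg by assumption. rewrite <- Eh.
- apply E, Hz.
- unfold in_U in *. eapply Rle_lt_trans; [apply Hwz, Hz|exact Hz].
Qed.

Theorem theorem3p3 (p : nat) (hp : (0 < p)%nat)
  (I : C -> Prop) (alpha : C -> C) (L : C -> (C -> C) -> C -> C)
  (hL : class_O p I alpha L)
  (hcomm : forall b : C, I b -> commutes_with_zderiv p (L b))
  (halpha : forall b b' : C, I b -> I b' -> alpha b = alpha b')
  (mu nu : R) (hmunu : ~ (mu = 0%R /\ nu = 0%R))
  (a : C) (ha : I a)
  (phi : C -> C) (hphi : analytic_in_U phi) (hphi0 : phi (RtoC 0) = RtoC 1)
  (f : C -> C) (hf : class_A p f)
  (hF : forall z : C, in_U z -> z <> RtoC 0 -> ex_segment_integral p (alpha a) f z) :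
  let F := integral_operator p (alpha a) f in
  (subordinate (Omega p L mu nu a f) phi
     <-> subordinate (Omega p L mu nu (a + RtoC 1)%C F) phi)
  /\
  (subordinate phi (Omega p L mu nu a f)
     <-> subordinate phi (Omega p L mu nu (a + RtoC 1)%C F)).
Proof.
intros F.
destruct (integral_operator_spec p (alpha a) f hp hf hF) as (Hc & HF & HD). fold F in HF, HD.
assert (ha1 : I (a + RtoC 1)%C) by (apply hL, ha).
assert (Hshift : forall b, I b -> forall z, in_U z -> L (b + RtoC 1)%C F z = L b f z).
{ intros b Hb. assert (E : alpha a = alpha b) by (apply halpha; assumption).
  apply (operator_integral_shift p I alpha); auto; rewrite <- E; assumption. }
assert (EO : forall z, in_U z -> Omega p L mu nu a f z = Omega p L mu nu (a + RtoC 1)%C F z).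
{ intros z Hz. unfold Omega. rewrite !Hshift by assumption. reflexivity. }
split; split; apply subordinate_ext; intros z Hz; auto; symmetry; auto.
Qed.
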